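(* Let $K$ be a field and $X$ a finite connected poset. The group $\mathrm{LAut}(I(X,K))$ of Lie automorphisms of the incidence algebra $I(X,K)$ is isomorphic to the semidirect product $\mathrm{Inn}_1(I(X,K))\rtimes\widetilde{\mathrm{LAut}}(I(X,K))$, where $\mathrm{Inn}_1(I(X,K))$ is the group of conjugations $f\mapsto \beta f\beta^{-1}$ by elements $\beta\in I(X,K)$ with $\beta(x,x)=1$ for all $x\in X$, and $\widetilde{\mathrm{LAut}}(I(X,K))$ is the image of the map $\varphi\mapsto\widetilde\varphi$ defined below.
   Context: A poset $X$ is connected if for any $x,y\in X$ there is a sequence $x=x_0,x_1,\dots,x_m=y$ in which, for each $i$, one of $x_i,x_{i+1}$ covers the other. The incidence algebra $I(X,K)$ is the $K$-vector space of functions $f:X\times X\to K$ with $f(x,y)=0$ unless $x\le y$, with product $(fg)(x,y)=\sum_{x\le t\le y}f(x,t)g(t,y)$. For $x\le y$, $e_{xy}$ denotes the function equal to $1$ at $(x,y)$ and $0$ elsewhere; $\{e_{xy}:x\le y\}$ is a basis. $I(X,K)$ is a Lie algebra under $[f,g]=fg-gf$, and a Lie automorphism is a bijective $K$-linear map preserving this bracket. For $x\le y$ let $\lfloor x,y\rfloor=\{z: x\le z\le y\}$ and let $l(\lfloor x,y\rfloor)$ be the maximum length of a chain in $\lfloor x,y\rfloor$ (the length of a chain is its cardinality minus one). For $i\ge0$ let $L_i=\mathrm{span}_K\{e_{xy}: l(\lfloor x,y\rfloor)=i\}$, so $I(X,K)=\bigoplus_{i\ge0}L_i$. For a Lie automorphism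 $\varphi$, $\widetilde\varphi$ is the $K$-linear map such that, for $e_{xy}\in L_i$, $\widetilde\varphi(e_{xy})$ is the component in $L_i$ of $\varphi(e_{xy})$ with respect to this direct sum decomposition (one has $\varphi(e_{xy})-\widetilde\varphi(e_{xy})\in\bigoplus_{k>i}L_k$). *)

(* Defs.v *)
From HB Require Import structures.
From mathcomp Require Import all_boot all_order all_algebra.
Set Implicit Arguments. Unset Strict Implicit. Unset Printing Implicit Defensive.
Import Order.TTheory GRing.Theory.
Local Open Scope ring_scope.

Section Incidence.
Variables (K : fieldType) (d : Order.disp_t) (X : finPOrderType d).

(* ambient space of all functions X x X -> K; I(X,K) is the subspace [incid] *)
Local Notation incfun := {ffun X * X -> K}.

Definition incid : pred incfun :=
  fun f => [forall x : X, forall y : X, ~~ (x <= y)%O ==> (f (x, y) == 0)].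

Definition imul (f g : incfun) : incfun :=
  [ffun p : X * X => \sum_(t : X | (p.1 <= t)%O && (t <= p.2)%O) f (p.1, t) * g (t, p.2)].

Definition ione : incfun := [ffun p : X * X => (p.1 == p.2)%:R].

Definition ibracket (f g : incfun) : incfun := imul f g - imul g f.

Definition iscale (a : K) (f : incfun) : incfun := [ffun p : X * X => a * f p].

Definition eunit (x y : X) : incfun := [ffun p : X * X => (p == (x, y))%:R].

Definition covers (x y : X) : bool :=
  (x < y)%O && [forall z : X, ~~ ((x < z)%O && (z < y)%O)].

Definition connected_poset : Prop :=
  forall x y : X, exists s : seq X,
    path (fun a b => covers a b || covers b a) x s /\ last x s = y.

Definition chain_in (x y : X) (C : {set X}) : bool :=
  [forall z : X, (z \in C) ==> ((x <= z)%O && (z <= y)%O)] &&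
  [forall z : X, forall w : X, ((z \in C) && (w \in C)) ==> ((z <= w)%O || (w <= z)%O)].

Definition ilen (x y : X) : nat := \max_(C : {set X} | chain_in x y C) (#|C|.-1)%N.

Definition compL (i : nat) (f : incfun) : incfun :=
  [ffun p : X * X => if ilen p.1 p.2 == i then f p else 0].

(* Lie automorphism of I(X,K): a bijective K-linear map of I(X,K) preserving
   the bracket (maps are represented on the ambient space; only their
   restriction to I(X,K) matters) *)
Definition lie_aut (phi : incfun -> incfun) : Prop :=
  [/\ {in incid, forall f, phi f \in incid},
      (forall (a : K) (f g : incfun), f \in incid -> g \in incid ->
          phi (iscale a f + g) = iscale a (phi f) + phi g),
      {in incid &, injective phi},
      (forall g, g \in incid -> exists2 f, f \in incid & phi f = g)
    & {in incid &, forall f g, phi (ibracket f g) = ibracket (phi f) (phi g)}].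

(* phi~ : the linear map with phi~(e_xy) = L_i-component of phi(e_xy),
   for e_xy in L_i *)
Definition tilde (phi : incfun -> incfun) (f : incfun) : incfun :=
  \sum_(p : X * X | (p.1 <= p.2)%O)
     iscale (f p) (compL (ilen p.1 p.2) (phi (eunit p.1 p.2))).

Definition inn1 (psi : incfun -> incfun) : Prop :=
  exists beta gamma : incfun,
    [/\ beta \in incid, gamma \in incid, (forall x : X, beta (x, x) = 1),
        imul beta gamma = ione /\ imul gamma beta = ione
      & {in incid, forall f, psi f = imul (imul beta f) gamma}].

Definition lautT (theta : incfun -> incfun) : Prop :=
  exists phi, lie_aut phi /\ {in incid, forall f, theta f = tilde phi f}.

Definition eqI (phi psi : incfun -> incfun) : Prop :=
  {in incid, forall f, phi f = psi f}.

End Incidence.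

(* Main.v *)
(* The spans F_k of the L_i with i >= k are Lie characteristic, because
   F_1 = [I, I] and F_(k+1) = [F_1, F_k]; so every Lie automorphism phi respects
   them.  The elements phi(e_xx) commute and their diagonal parts span the
   diagonal subalgebra D, hence separate any two points of X.  Successive
   conjugations by 1 + b with b in L_k therefore move them into D + F_k for all
   k, and phi = psi o theta with psi in Inn_1 and theta(D) = D.  Such a theta
   permutes the root lines K e_xy (x < y) up to scalars; since it respects the
   F_k, it preserves every L_i.  Elements of Inn_1 act trivially on the quotients
   F_k / F_(k+1), so phi~ = theta: LAut~ is the group of Lie automorphisms
   preserving all L_i, and Inn_1 is the kernel of the action on the associated
   graded space. *)
Require Import Defs.
From HB Require Import structures.
From mathcomp Require Import all_boot all_order all_algebra.
From mathcomp Require Import zify ring.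
Set Implicit Arguments.
Unset Strict Implicit.
Unset Printing Implicit Defensive.
Import Order.TTheory GRing.Theory.

(** * Lengths of intervals in a finite poset *)

Section IntervalLength.
Variables (d : Order.disp_t) (X : finPOrderType d).
Implicit Types (x y z : X) (C : {set X}).

Lemma chain_inP x y C :
  reflect ((forall z, z \in C -> (x <= z <= y)%O) /\
           {in C &, forall z w, (z <= w)%O || (w <= z)%O})
          (chain_in x y C).
Proof.
apply: (iffP andP) => -[H1 H2]; split.
- by move=> z zC; move/forallP/(_ z)/implyP: H1; apply.
- by move=> z w zC wC; move/forallP/(_ z)/forallP/(_ w)/implyP: H2; apply; rewrite zC.
- by apply/forallP=> z; apply/implyP=> /H1.
- apply/forallP=> z; apply/forallP=> w; apply/implyP=> /andP[zC wC].
  exact: H2.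
Qed.

Lemma chain_in_card x y C : chain_in x y C -> (#|C|.-1 <= ilen x y)%N.
Proof.
exact: (@leq_bigmax_cond _ (chain_in x y) (fun C : {set X} => #|C|.-1)).
Qed.

Lemma ilen_chain x y : exists2 C, chain_in x y C & ilen x y = #|C|.-1.
Proof.
have ch0 : chain_in x y set0.
  by apply/chain_inP; split=> [z|z w]; rewrite inE.
have [|C cC eC] := @eq_bigmax_cond _ (chain_in x y) (fun C : {set X} => #|C|.-1).
  by apply/card_gt0P; exists set0.
by exists C.
Qed.

Lemma ilen_refl x : ilen x x = 0%N.
Proof.
have [C /chain_inP[cC _] ->] := ilen_chain x x.
have : C \subset [set x].
  by apply/subsetP=> z /cC; rewrite inE andbC => /le_anti ->.
by move/subset_leq_card; rewrite cards1; case: #|C| => [|[]].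
Qed.

Lemma ilen_gt0 x y : (x < y)%O -> (0 < ilen x y)%N.
Proof.
move=> xy; have: chain_in x y [set x; y].
  apply/chain_inP; split=> [z|z w]; rewrite !inE.
    by case/orP=> /eqP->; rewrite lexx ltW.
  by do 2![case/orP=> /eqP->]; rewrite ?lexx ?(ltW xy) ?orbT.
by move/chain_in_card; rewrite cards2 lt_eqF.
Qed.

Lemma ilen_max x y : (ilen x y < #|X|.+1)%N.
Proof.
have [C _ ->] := ilen_chain x y.
by rewrite ltnS; apply: leq_trans (leq_pred _) (max_card _).
Qed.

(** Longest chains of the two intervals unite to a chain, and they share at most [z]. *)
Lemma ilen_add x z y :
  (x <= z)%O -> (z <= y)%O -> (ilen x z + ilen z y <= ilen x y)%N.
Proof.
move=> xz zy.
have [C1 /chain_inP[b1 c1] ->] := ilen_chain x z.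
have [C2 /chain_inP[b2 c2] ->] := ilen_chain z y.
have cU : chain_in x y (C1 :|: C2).
  apply/chain_inP; split=> [t|t w]; rewrite !inE.
    case/orP=> [/b1|/b2] /andP[h1 h2].
      by rewrite h1 (le_trans h2).
    by rewrite h2 (le_trans _ h1).
  case/orP=> ht /orP[] hw; try by [apply: c1|apply: c2].
    by case/andP: (b1 _ ht) (b2 _ hw) => _ h /andP[h' _]; rewrite (le_trans h).
  by case/andP: (b2 _ ht) (b1 _ hw) => h _ /andP[_ h']; rewrite (le_trans h') ?orbT.
have sI : C1 :&: C2 \subset [set z].
  apply/subsetP=> t; rewrite !inE => /andP[/b1/andP[_ h] /b2/andP[h' _]].
  by rewrite eq_le h.
move/chain_in_card: cU; rewrite cardsU; move/subset_leq_card: sI; rewrite cards1.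
have := subset_leq_card (subsetIl C1 C2); have := subset_leq_card (subsetIr C1 C2).
by lia.
Qed.

(** Supplies the factorization behind F_(k+1) = [F_1, F_k]. Dropping [x] from a longest chain, the
    least remaining element serves as [z]; since [0 < k], at least two elements remain, whence
    [z < y]. *)
Lemma ilen_split k x y : (0 < k)%N -> (k.+1 <= ilen x y)%N ->
  exists z, [/\ (x < z)%O, (z < y)%O & (k <= ilen z y)%N].
Proof.
move=> k0; have [C /chain_inP[bC cC] ->] := ilen_chain x y => hk.
set C' := C :\ x.
have cardC' : (k.+1 <= #|C'|)%N by have := cardsD1 x C; rewrite -/C'; lia.
have [z0 z0C] : exists z, z \in C' by apply/card_gt0P; lia.
(* The least element of [C'] is the one with the fewest elements of [C'] below it. *)
have [z zC zmin] :=
  @arg_minnP _ z0 [in C'] (fun z => #|[set w in C' | (w <= z)%O]|) z0C.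
have C'ge w : w \in C' -> (z <= w)%O.
  move=> wC; move: (wC) (zC); rewrite !inE => /andP[_ wC1] /andP[_ zC1].
  case/orP: (cC _ _ zC1 wC1) => // wz; have := zmin _ wC.
  case: (eqVneq w z) => [->//|nwz].
  rewrite leqNgt => /negP[]; apply: proper_card; apply/properP; split.
    by apply/subsetP=> t; rewrite !inE => /andP[-> /le_trans]; apply.
  exists z; first by rewrite inE zC lexx.
  by rewrite !inE negb_and; apply/orP; right; apply: contra nwz => h; rewrite eq_le wz.
have leC' w : w \in C' -> (w <= y)%O by rewrite inE => /andP[_ /bC/andP[]].
exists z; split.
- by move: zC; rewrite !inE => /andP[nzx /bC/andP[h _]]; rewrite lt_neqAle eq_sym nzx.
- have /card_gt0P[w] : (0 < #|C' :\ z|)%N by have := cardsD1 z C'; rewrite zC; lia.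
  rewrite in_setD1 => /andP[nwz wC].
  by apply: lt_le_trans (leC' _ wC); rewrite lt_neqAle eq_sym nwz C'ge.
- have /chain_in_card : chain_in z y C'; last by lia.
  apply/chain_inP; split=> [w wC|w t]; first by rewrite C'ge ?leC'.
  by rewrite !inE => /andP[_ ?] /andP[_ ?]; apply: cC.
Qed.

Lemma ilen_eq0 x y : (x <= y)%O -> (ilen x y == 0)%N = (x == y).
Proof.
rewrite le_eqVlt => /orP[/eqP->|xy]; first by rewrite ilen_refl !eqxx.
by rewrite (lt_eqF xy); apply/negbTE; rewrite -lt0n ilen_gt0.
Qed.

End IntervalLength.

(** * Convolution and the radical filtration *)

Section IncidenceAlgebra.
Local Open Scope ring_scope.
Variables (K : fieldType) (d : Order.disp_t) (X : finPOrderType d).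
Local Notation incfun := {ffun X * X -> K}.
Local Notation incid := (@incid K d X).
Local Notation ione := (@ione K d X).
Local Notation inn1 := (@inn1 K d X).
Local Notation lie_aut := (@lie_aut K d X).
Local Notation lautT := (@lautT K d X).
Local Notation eqI := (@eqI K d X).
Implicit Types (f g h : incfun) (x y z u v : X) (p : X * X).

(* Convolution over all of [X]: it agrees with [imul] on incidence functions
   but is associative and bilinear with no side conditions. *)
Definition conv f g : incfun := [ffun p => \sum_t f (p.1, t) * g (t, p.2)].
Local Notation "f ** g" := (conv f g) (at level 40, left associativity).

Lemma convA f g h : f ** (g ** h) = f ** g ** h.
Proof.
apply/ffunP=> p; rewrite !ffunE.
under eq_bigr => t _ do rewrite ffunE /= big_distrr /=.
rewrite exchange_big /=; apply: eq_bigr => t _.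
rewrite ffunE /= big_distrl /=; apply: eq_bigr => s _.
by rewrite mulrA.
Qed.

Lemma convDl f g h : (f + g) ** h = f ** h + g ** h.
Proof.
apply/ffunP=> p; rewrite !ffunE -big_split; apply: eq_bigr => t _.
by rewrite ffunE mulrDl.
Qed.

Lemma convDr f g h : f ** (g + h) = f ** g + f ** h.
Proof.
apply/ffunP=> p; rewrite !ffunE -big_split; apply: eq_bigr => t _.
by rewrite ffunE mulrDr.
Qed.

Lemma convZl a f g : iscale a f ** g = iscale a (f ** g).
Proof.
apply/ffunP=> p; rewrite !ffunE big_distrr /=; apply: eq_bigr => t _.
by rewrite ffunE mulrA.
Qed.

Lemma convZr a f g : f ** iscale a g = iscale a (f ** g).
Proof.
apply/ffunP=> p; rewrite !ffunE big_distrr /=; apply: eq_bigr => t _.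
by rewrite ffunE mulrCA.
Qed.

Lemma iscaleN1 f : iscale (-1) f = - f.
Proof. by apply/ffunP=> p; rewrite !ffunE mulN1r. Qed.

Lemma convNl f g : (- f) ** g = - (f ** g).
Proof. by rewrite -!iscaleN1 convZl. Qed.

Lemma convNr f g : f ** (- g) = - (f ** g).
Proof. by rewrite -!iscaleN1 convZr. Qed.

Lemma conv1 f : ione ** f = f.
Proof.
apply/ffunP=> -[x y]; rewrite ffunE /= (bigD1 x) //= big1 => [|t ntx].
  by rewrite ffunE eqxx mul1r addr0.
by rewrite ffunE /= eq_sym (negbTE ntx) mul0r.
Qed.

Lemma conv1r f : f ** ione = f.
Proof.
apply/ffunP=> -[x y]; rewrite ffunE /= (bigD1 y) //= big1 => [|t nty].
  by rewrite ffunE eqxx mulr1 addr0.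
by rewrite ffunE /= (negbTE nty) mulr0.
Qed.

(* [filt k] is the sum of the [L_i], [i >= k]; it is the [k]-th power of the
   Jacobson radical. *)
Definition filt (k : nat) f :=
  forall x y, ~~ ((x <= y)%O && (k <= ilen x y)%N) -> f (x, y) = 0.

(* [diagonal + filt k] *)
Definition dfilt (k : nat) f :=
  forall x y, x != y -> ~~ ((x <= y)%O && (k <= ilen x y)%N) -> f (x, y) = 0.

Lemma filt0P f : reflect (filt 0 f) (f \in incid).
Proof.
apply: (iffP forallP) => H x => [y|].
  rewrite leq0n andbT => nxy; apply/eqP.
  by move/forallP/(_ y)/implyP: (H x); apply.
by apply/forallP=> y; apply/implyP=> nxy; rewrite (H x y) // leq0n andbT.
Qed.

Lemma filtW j k f : (j <= k)%N -> filt k f -> filt j f.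
Proof.
move=> jk H x y nh; apply: H; apply: contra nh => /andP[-> h].
exact: leq_trans h.
Qed.

Lemma filt_incid k f : filt k f -> f \in incid.
Proof. by move=> h; apply/filt0P; apply: filtW h. Qed.

Lemma filt_zero k : filt k 0.
Proof. by move=> x y _; rewrite ffunE. Qed.

Lemma filtD k f g : filt k f -> filt k g -> filt k (f + g).
Proof. by move=> F G x y h; rewrite ffunE F // G // addr0. Qed.

Lemma filtZ k a f : filt k f -> filt k (iscale a f).
Proof. by move=> F x y h; rewrite ffunE F // mulr0. Qed.

Lemma filtN k f : filt k f -> filt k (- f).
Proof. by rewrite -iscaleN1; apply: filtZ. Qed.

Lemma filtB k f g : filt k f -> filt k g -> filt k (f - g).
Proof. by move=> F G; apply: filtD => //; apply: filtN. Qed.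

Lemma filt_sum k (I : Type) (r : seq I) (P : pred I) (F : I -> incfun) :
  (forall i, P i -> filt k (F i)) -> filt k (\sum_(i <- r | P i) F i).
Proof. move=> H; elim/big_ind: _ => //; [exact: filt_zero|exact: filtD]. Qed.

Lemma filt_conv i j f g : filt i f -> filt j g -> filt (i + j) (f ** g).
Proof.
move=> F G x y nxy; rewrite ffunE big1 // => t _ /=.
case: (boolP ((x <= t)%O && (i <= ilen x t)%N)) => [/andP[xt it]|/F->]; last first.
  by rewrite mul0r.
case: (boolP ((t <= y)%O && (j <= ilen t y)%N)) => [/andP[ty jt]|/G->]; last first.
  by rewrite mulr0.
case/negP: nxy; rewrite (le_trans xt ty) /=.
by apply: leq_trans (ilen_add xt ty); apply: leq_add.
Qed.

Lemma filt_max f : filt #|X|.+1 f -> f = 0.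
Proof.
by move=> H; apply/ffunP=> -[x y]; rewrite ffunE H // leqNgt ilen_max andbF.
Qed.

Lemma filt_diag k f x : filt k.+1 f -> f (x, x) = 0.
Proof. by move=> H; apply: H; rewrite ilen_refl andbF. Qed.

Lemma filt1P f : f \in incid -> (forall x, f (x, x) = 0) -> filt 1 f.
Proof.
move=> /filt0P F f0 x y; rewrite lt0n negb_and negbK.
have [xy /=|nxy _] := boolP (x <= y)%O; last by apply: F; rewrite negb_and nxy.
by rewrite ilen_eq0 // => /eqP<-.
Qed.

Lemma incidD f g : f \in incid -> g \in incid -> f + g \in incid.
Proof. by move=> /filt0P F /filt0P G; apply/filt0P; apply: filtD. Qed.

Lemma incidB f g : f \in incid -> g \in incid -> f - g \in incid.
Proof. by move=> /filt0P F /filt0P G; apply/filt0P; apply: filtB. Qed.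

Lemma incidZ a f : f \in incid -> iscale a f \in incid.
Proof. by move=> /filt0P F; apply/filt0P; apply: filtZ. Qed.

Lemma incid0 : 0 \in incid.
Proof. by apply/filt0P; apply: filt_zero. Qed.

Lemma incid_conv f g : f \in incid -> g \in incid -> f ** g \in incid.
Proof. by move=> /filt0P F /filt0P G; apply/filt0P; apply: (@filt_conv 0 0). Qed.

Lemma incid1 : ione \in incid.
Proof.
apply/filt0P=> x y; rewrite leq0n andbT ffunE /= => nxy.
by case: eqP nxy => // ->; rewrite lexx.
Qed.

Lemma incid_eunit x y : (x <= y)%O -> eunit K x y \in incid.
Proof.
move=> xy; apply/filt0P=> u v; rewrite leq0n andbT ffunE => nuv.
by case: eqP nuv => // -[-> ->]; rewrite xy.
Qed.

Lemma filt_eunit x y : (x <= y)%O -> filt (ilen x y) (eunit K x y).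
Proof.
move=> xy u v; rewrite ffunE; case: eqP => // -[-> ->].
by rewrite xy leqnn.
Qed.

(** * Products, brackets and diagonal entries of incidence functions *)

Lemma imulE f g : f \in incid -> g \in incid -> imul f g = f ** g.
Proof.
move=> /filt0P F /filt0P G; apply/ffunP=> -[x y]; rewrite !ffunE /=.
rewrite [RHS](bigID (fun t => (x <= t)%O && (t <= y)%O)) /= [X in _ + X]big1 ?addr0 //.
move=> t; rewrite negb_and => /orP[h|h].
  by rewrite F ?mul0r // negb_and h.
by rewrite G ?mulr0 // negb_and h.
Qed.

Lemma subffE f g p : (f - g) p = f p - g p.
Proof. by rewrite !ffunE. Qed.

Definition comm f g := f ** g - g ** f.

Lemma ibracketE f g : f \in incid -> g \in incid -> ibracket f g = comm f g.
Proof. by move=> F G; rewrite /ibracket !imulE. Qed.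

Lemma incid_comm f g : f \in incid -> g \in incid -> comm f g \in incid.
Proof. by move=> F G; rewrite incidB ?incid_conv. Qed.

Lemma filt_comm i j f g : filt i f -> filt j g -> filt (i + j) (comm f g).
Proof. by move=> F G; apply: filtB; [|rewrite addnC]; apply: filt_conv. Qed.

Lemma conv_diag f g x : f \in incid -> g \in incid ->
  (f ** g) (x, x) = f (x, x) * g (x, x).
Proof.
move=> /filt0P F /filt0P G; rewrite ffunE (bigD1 x) //= big1 ?addr0 // => t ntx.
have [xt|nxt] := boolP (x <= t)%O; last by rewrite F ?mul0r // negb_and nxt.
rewrite G ?mulr0 //= andbT; apply: contra ntx => tx.
by rewrite eq_le tx.
Qed.

Lemma filt1_comm f g : f \in incid -> g \in incid -> filt 1 (comm f g).
Proof.
move=> F G; apply: filt1P; first exact: incid_comm.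
by move=> x; rewrite subffE !conv_diag // mulrC subrr.
Qed.

Lemma dfilt_incid k f : dfilt k f -> f \in incid.
Proof.
move=> F; apply/filt0P=> x y; rewrite leq0n andbT => nxy.
apply: F; last by rewrite negb_and nxy.
by apply: contra nxy => /eqP->.
Qed.

Lemma dfilt1 f : f \in incid -> dfilt 1 f.
Proof.
move=> /filt0P F x y nxy; rewrite negb_and lt0n negbK.
have [xy /=|xy _] := boolP (x <= y)%O; last by apply: F; rewrite negb_and xy.
by rewrite ilen_eq0 // (negbTE nxy).
Qed.

Lemma dfiltS k f : dfilt k f ->
  (forall u v, u != v -> (u <= v)%O -> ilen u v = k -> f (u, v) = 0) -> dfilt k.+1 f.
Proof.
move=> F fk u v nuv; rewrite negb_and -leqNgt.
have [uv /=|uv _] := boolP (u <= v)%O; last by apply: F; rewrite // negb_and uv.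
rewrite leq_eqVlt => /orP[/eqP|] h; first exact: fk.
by apply: F; rewrite // uv -ltnNge.
Qed.

Lemma dfilt_max f u v : dfilt #|X|.+1 f -> u != v -> f (u, v) = 0.
Proof. by move=> F nuv; apply: F; rewrite // leqNgt ilen_max andbF. Qed.

(** A contributing intermediate [t] other than [u] and [v] would force [ilen u v > k] by
    [ilen_add]. *)
Lemma conv_dfilt k f g u v : dfilt k f -> dfilt k g -> u != v -> ilen u v = k ->
  (f ** g) (u, v) = f (u, u) * g (u, v) + f (u, v) * g (v, v).
Proof.
move=> F G nuv kuv; rewrite ffunE /= (bigD1 u) //= (bigD1 v) /=; last by rewrite eq_sym.
rewrite big1 ?addr0 // => t /andP[ntu ntv].
case: (boolP ((u <= t)%O && (k <= ilen u t)%N)) => [/andP[ut kt]|h]; last first.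
  by rewrite F ?mul0r // eq_sym.
rewrite G ?mulr0 //; apply/negP=> /andP[tv kt'].
have := ilen_add ut tv; have := @ilen_gt0 _ X t v.
by rewrite lt_neqAle ntv tv kuv => /(_ isT); lia.
Qed.

Lemma incid_expand f : f \in incid ->
  f = \sum_(p : X * X | (p.1 <= p.2)%O) iscale (f p) (eunit K p.1 p.2).
Proof.
move=> /filt0P F; apply/ffunP=> -[x y]; rewrite sum_ffunE.
under eq_bigr => p _ do rewrite !ffunE -surjective_pairing.
have [xy|nxy] := boolP (x <= y)%O.
  rewrite (bigD1 (x, y)) //= eqxx mulr1 big1 ?addr0 // => p /andP[_ np].
  by rewrite eq_sym (negbTE np) mulr0.
rewrite F ?negb_and ?nxy // big1 // => p pp.
by case: eqP pp nxy => [<- /= -> //|_ _ _]; rewrite mulr0.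
Qed.

(** * Unipotent elements, matrix units and the group Inn_1 *)

Lemma unipotent_incid b : filt 1 (b - ione) -> b \in incid.
Proof. by move=> /filt_incid B; rewrite -[b](subrK ione) incidD ?incid1. Qed.

Lemma unipotent_inv b : filt 1 (b - ione) ->
  exists g, [/\ filt 1 (g - ione), b ** g = ione & g ** b = ione].
Proof.
have right_inv b0 : filt 1 (b0 - ione) ->
    exists g, filt 1 (g - ione) /\ b0 ** g = ione.
  move=> B; pose n := b0 - ione.
  have step k : exists g, filt 1 (g - ione) /\ filt k (b0 ** g - ione).
    elim: k => [|k [g [G R]]].
      exists ione; rewrite subrr conv1r; split; [exact: filt_zero|exact: filtW B].
    have ng : filt 1 (n ** g).
      by apply: (@filt_conv 1 0) => //; apply/filt0P; apply: unipotent_incid.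
    (* The equation [b0 ** g = ione] reads [g = ione - n ** g]; one iteration multiplies the error
       by [- n], gaining one degree of filtration. *)
    exists (ione - n ** g); split; first by rewrite addrAC subrr sub0r; apply: filtN.
    suff -> : b0 ** (ione - n ** g) - ione = - (n ** (b0 ** g - ione)).
      by apply: filtN; apply: (@filt_conv 1 k).
    have comb : b0 ** n = n ** b0.
      by rewrite /n convDr convDl convNr convNl conv1 conv1r.
    by rewrite !convDr !convNr !conv1r convA comb -convA opprB addrAC.
  have [g [G /filt_max/subr0_eq bg]] := step #|X|.+1.
  by exists g.
(* [g] is unipotent too, and its right inverse [h] must equal [b]. *)
move=> B; have [g [G bg]] := right_inv _ B; have [h [_ gh]] := right_inv _ G.
exists g; split=> //.
suff -> : b = h by [].
by rewrite -[b]conv1r -gh convA bg conv1.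
Qed.

Lemma conv_eunit x y z w :
  eunit K x y ** eunit K z w = iscale (y == z)%:R (eunit K x w).
Proof.
apply/ffunP=> -[u v]; rewrite !ffunE /= (bigD1 y) //= big1 ?addr0 => [|t nty].
  rewrite !ffunE !xpair_eqE eqxx andbT.
  by case: (u == x); case: (y == z); case: (v == w); rewrite ?(mulr0, mul0r, mulr1).
by rewrite !ffunE !xpair_eqE (negbTE nty) andbF mul0r.
Qed.

(** With [z = x] this puts every e_xy with [x < y] in the derived algebra; with [x < z < y] it
    reaches long intervals from shorter ones. *)
Lemma comm_eunit x z y : x != y -> comm (eunit K x z) (eunit K z y) = eunit K x y.
Proof.
move=> nxy; rewrite /comm !conv_eunit eqxx eq_sym (negbTE nxy).
by apply/ffunP=> p; rewrite !ffunE mul1r mul0r subr0.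
Qed.

Lemma unipotentP b : b \in incid ->
  filt 1 (b - ione) <-> forall x, b (x, x) = 1.
Proof.
move=> B; split=> [H x|H].
  by apply/subr0_eq; have := filt_diag x H; rewrite subffE ffunE eqxx.
apply: filt1P; first by rewrite incidB ?incid1.
by move=> x; rewrite subffE H ffunE eqxx subrr.
Qed.

(** Diagonal entries multiply, so the inverse of a unipotent element is unipotent; the description
    becomes symmetric in [b] and [g]. *)
Lemma inn1P (psi : incfun -> incfun) :
  inn1 psi <-> exists b g, [/\ filt 1 (b - ione), filt 1 (g - ione),
     b ** g = ione, g ** b = ione & {in incid, forall f, psi f = b ** f ** g}].
Proof.
split=> -[b [g]].
  case=> B G b1 [bg gb] E; rewrite imulE // in bg; rewrite imulE // in gb.
  exists b, g; split=> //; [exact/unipotentP|apply/unipotentP=> // x|].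
    by have := conv_diag x B G; rewrite bg ffunE eqxx b1 mul1r => <-.
  by move=> f F; rewrite E // !imulE // incid_conv.
case=> UB UG bg gb E.
have B := unipotent_incid UB; have G := unipotent_incid UG.
exists b, g; split=> //; [exact/unipotentP|by rewrite !imulE|].
by move=> f F; rewrite E // !imulE // incid_conv.
Qed.

Lemma inn1_conj b : filt 1 (b - ione) ->
  exists g, g ** b = ione /\ inn1 (fun f => b ** f ** g).
Proof.
move=> B; have [g [G bg gb]] := unipotent_inv B.
by exists g; split=> //; apply/inn1P; exists b, g.
Qed.

Lemma inn1_incid psi f : inn1 psi -> f \in incid -> psi f \in incid.
Proof.
move=> /inn1P[b [g [/unipotent_incid B /unipotent_incid G _ _ E]]] F.
by rewrite E // !incid_conv.
Qed.

(** The difference equals [comm (b - ione) f ** g], and [b - ione] has degree 1. *)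
Lemma inn1_filt psi k f : inn1 psi -> filt k f -> filt k.+1 (psi f - f).
Proof.
move=> /inn1P[b [g [B /unipotent_incid/filt0P G bg gb E]]] F.
have -> : psi f - f = comm (b - ione) f ** g.
  rewrite E; last exact: filt_incid F.
  have -> : comm (b - ione) f = b ** f - f ** b.
    rewrite /comm convDl convDr convNl convNr conv1 conv1r.
    by rewrite opprB addrA subrK.
  by rewrite convDl convNl -(convA f) bg conv1r.
by rewrite -[k.+1]addn0; apply: filt_conv G; apply: (@filt_comm 1).
Qed.

Lemma inn1_id : inn1 (fun f : incfun => f).
Proof.
apply/inn1P; exists ione, ione; rewrite !subrr !conv1.
by split=> //; [exact: filt_zero..|move=> f _; rewrite conv1 conv1r].
Qed.

Lemma inn1_comp psi chi : inn1 psi -> inn1 chi -> inn1 (psi \o chi).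
Proof.
move=> ip ic; have inc := inn1_incid ic; move: ip ic.
move=> /inn1P[b [g [B G bg gb E]]] /inn1P[b' [g' [B' G' bg' gb' E']]].
apply/inn1P; exists (b ** b'), (g' ** g); split.
- have -> : b ** b' - ione = b ** (b' - ione) + (b - ione).
    by rewrite convDr convNr conv1r addrA addrNK.
  by apply: filtD => //; apply: (@filt_conv 0 1) => //; apply/filt0P/unipotent_incid.
- have -> : g' ** g - ione = g' ** (g - ione) + (g' - ione).
    by rewrite convDr convNr conv1r addrA addrNK.
  by apply: filtD => //; apply: (@filt_conv 0 1) => //; apply/filt0P/unipotent_incid.
- by rewrite convA -(convA b) bg' conv1r.
- by rewrite convA -(convA g') gb conv1r.
- by move=> f F; rewrite /= E ?inc // E' // !convA.
Qed.

Lemma inn1_inv psi : inn1 psi ->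
  exists chi, inn1 chi /\ eqI (psi \o chi) id /\ eqI (chi \o psi) id.
Proof.
move=> /inn1P[b [g [B G bg gb E]]]; exists (fun f => g ** f ** b).
have ig : inn1 (fun f => g ** f ** b) by apply/inn1P; exists g, b.
split=> //; split=> f F /=.
  rewrite E; last exact: inn1_incid ig F.
  by rewrite !convA bg conv1 -convA bg conv1r.
by rewrite E // !convA gb conv1 -convA gb conv1r.
Qed.

Lemma inn1_laut psi : inn1 psi -> lie_aut psi.
Proof.
move=> ip; have inc f := @inn1_incid psi f ip.
have [chi [ic [pc cp]]] := inn1_inv ip.
have /inn1P[b [g [B G bg gb E]]] := ip; split.
- by move=> f; apply: inc.
- move=> a f h F H; rewrite !E ?incidD ?incidZ //.
  by rewrite convDr convDl convZr convZl.
- by move=> f h F H e; rewrite -(cp f F) /= e; apply: cp.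
- by move=> h H; exists (chi h); [exact: inn1_incid | exact: pc].
- move=> f h F H; rewrite !ibracketE ?inc // !E ?incid_comm //.
  rewrite /comm convDr convDl convNr convNl !convA.
  by rewrite -!(convA _ g b) gb !conv1r.
Qed.

(** * Lie automorphisms: linearity, filtration, inverses and composites *)

Section LieAut.
Variable phi : incfun -> incfun.
Hypothesis phiL : lie_aut phi.

Lemma laut_incid f : f \in incid -> phi f \in incid.
Proof. by case: phiL => H _ _ _ _; apply: H. Qed.

Lemma laut_inj f g : f \in incid -> g \in incid -> phi f = phi g -> f = g.
Proof. by case: phiL => _ _ H _ _; apply: H. Qed.

Lemma laut_surj g : g \in incid -> exists2 f, f \in incid & phi f = g.
Proof. by case: phiL => _ _ _ H _; apply: H. Qed.

Lemma laut_comm f g : f \in incid -> g \in incid ->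
  phi (comm f g) = comm (phi f) (phi g).
Proof.
by move=> F G; rewrite -!ibracketE ?laut_incid //; case: phiL => _ _ _ _; apply.
Qed.

Lemma lautD f g : f \in incid -> g \in incid -> phi (f + g) = phi f + phi g.
Proof.
have s1 h : iscale 1 h = h by apply/ffunP=> p; rewrite ffunE mul1r.
by move=> F G; case: phiL => _ /(_ 1 f g F G) + _ _ _; rewrite !s1.
Qed.

Lemma laut0 : phi 0 = 0.
Proof.
by apply: (@addrI _ (phi 0)); rewrite addr0 -lautD ?incid0 // addr0.
Qed.

Lemma lautZ a f : f \in incid -> phi (iscale a f) = iscale a (phi f).
Proof.
move=> F; have [_ lin _ _ _] := phiL.
by rewrite -[iscale a f]addr0 lin ?incid0 // laut0 addr0.
Qed.

Lemma lautB f g : f \in incid -> g \in incid -> phi (f - g) = phi f - phi g.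
Proof.
by move=> F G; rewrite -iscaleN1 lautD ?incidZ // lautZ // iscaleN1.
Qed.

Lemma laut_sum (I : Type) (r : seq I) (P : pred I) (a : I -> K) (F : I -> incfun) :
  (forall i, P i -> F i \in incid) ->
  phi (\sum_(i <- r | P i) iscale (a i) (F i)) =
  \sum_(i <- r | P i) iscale (a i) (phi (F i)).
Proof.
move=> H; elim: r => [|i r IH]; first by rewrite !big_nil laut0.
rewrite !big_cons; case: ifP => // Pi; rewrite lautD ?incidZ ?H // ?lautZ ?H ?IH //.
apply/filt0P; apply: filt_sum => j Pj; apply/filt0P; exact/incidZ/H.
Qed.

Lemma laut_expand f : f \in incid ->
  phi f = \sum_(p : X * X | (p.1 <= p.2)%O) iscale (f p) (phi (eunit K p.1 p.2)).
Proof.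
move=> F; rewrite {1}(incid_expand F) laut_sum // => p.
exact: incid_eunit.
Qed.

(** By linearity matrix units suffice; they are brackets by [comm_eunit], with midpoints from
    [ilen_split]. *)
Lemma laut_filt k f : filt k f -> filt k (phi f).
Proof.
have base j x y : (x <= y)%O -> (j <= ilen x y)%N -> filt j (phi (eunit K x y)).
  elim: j x y => [|[|j] IH] x y xy jxy.
  - by apply/filt0P; apply: laut_incid; apply: incid_eunit.
  - have nxy : x != y by rewrite -ilen_eq0 // -lt0n.
    rewrite -(@comm_eunit x x y) // laut_comm ?incid_eunit //.
    by apply: filt1_comm; apply: laut_incid; apply: incid_eunit.
  have [z [xz zy jz]] := ilen_split (ltn0Sn j) jxy.
  rewrite -(@comm_eunit x z y) ?(lt_eqF (lt_trans xz zy)) //.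
  rewrite laut_comm ?incid_eunit ?ltW //.
  apply: (@filt_comm 1 j.+1); last exact: IH (ltW zy) jz.
  (* The induction hypothesis covers index [j.+1] only, so degree 1 for the image of e_xz is
     obtained again from e_xz = [e_xx, e_xz]. *)
  have xz' := ltW xz; have nxz : x != z by rewrite lt_eqF.
  rewrite -(@comm_eunit x x z) // laut_comm ?incid_eunit //.
  by apply: filt1_comm; apply: laut_incid; apply: incid_eunit.
move=> F; rewrite (laut_expand (filt_incid F)); apply: filt_sum => -[x y] /= xy.
have [kxy|kxy] := leqP k (ilen x y); first exact/filtZ/base.
rewrite F; last by rewrite xy -ltnNge.
by move=> u v _; rewrite ffunE mul0r.
Qed.

Lemma laut_inv :
  exists chi, lie_aut chi /\ eqI (phi \o chi) id /\ eqI (chi \o phi) id.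
Proof.
have surj g : g \in incid -> exists f, (f \in incid) && (phi f == g).
  by move=> /laut_surj[f F <-]; exists f; rewrite F eqxx.
(* Matching on [idP] hands the membership proof to [xchoose]; the value 0 outside [incid] is
   arbitrary. *)
pose chi g := if @idP (g \in incid) is ReflectT G then xchoose (surj g G) else 0.
have chiP g : g \in incid -> chi g \in incid /\ phi (chi g) = g.
  rewrite /chi; case: {-}_ / idP => // G _.
  by have /andP[? /eqP] := xchooseP (surj g G).
have inc g G := (chiP g G).1; have pc g G := (chiP g G).2.
exists chi; split; last split; [split| |].
- by move=> g /chiP[].
- move=> a f g F G; apply: laut_inj; rewrite ?incidD ?inc ?incidZ ?inc ?incidD ?incidZ //.
  by rewrite lautD ?incidZ ?inc // lautZ ?inc // !pc ?incidD ?incidZ.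
- by move=> f g F G e; rewrite -(pc f F) e pc.
- move=> g G; exists (phi g); first exact: laut_incid.
  by apply: laut_inj; rewrite ?inc ?pc ?laut_incid.
- move=> f g F G; rewrite !ibracketE ?inc //.
  by apply: laut_inj; rewrite ?incid_comm ?inc ?incid_comm // laut_comm ?inc // !pc ?incid_comm.
- by move=> f F; apply: pc.
- by move=> f F /=; apply: laut_inj; rewrite ?inc ?pc ?laut_incid.
Qed.

End LieAut.
Lemma laut_eq phi psi : eqI phi psi -> lie_aut phi -> lie_aut psi.
Proof.
move=> e L; split.
- by move=> f F; rewrite -e // (laut_incid L).
- move=> a f g F G; rewrite -!e ?incidD ?incidZ //.
  by rewrite (lautD L) ?incidZ // (lautZ L).
- by move=> f g F G; rewrite -!e //; apply: (laut_inj L).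
- by move=> g /(laut_surj L)[f F <-]; exists f; rewrite ?e.
- move=> f g F G; rewrite -!e //; last by rewrite ibracketE ?incid_comm.
  by rewrite !ibracketE ?(laut_incid L) // (laut_comm L).
Qed.

Lemma laut_comp phi psi : lie_aut phi -> lie_aut psi -> lie_aut (phi \o psi).
Proof.
move=> L M; have inL := laut_incid L; have inM := laut_incid M; split=> /=.
- by move=> f F; rewrite inL ?inM.
- move=> a f g F G; rewrite (lautD M) ?incidZ // (lautZ M) //.
  by rewrite (lautD L) ?incidZ ?inM // (lautZ L) // inM.
- by move=> f g F G /(laut_inj L) e; apply: (laut_inj M) => //; apply: e; apply: inM.
- move=> g /(laut_surj L)[f /(laut_surj M)[h H <-] <-].
  by exists h.
- move=> f g F G; rewrite !ibracketE ?inL ?inM //.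
  by rewrite (laut_comm M) // (laut_comm L) // inM.
Qed.

(** * Diagonalizing the images of the e_xx by conjugation *)

(* Conjugating by 1 + b with b in [L_k] changes the [L_k]-component of [h] by
   [[b, h]]; commutation makes these components a coboundary of the diagonal
   parts, and [b] is the quotient by the separating root. *)
Lemma conj_diag_step (k : nat) (h : X -> incfun) : (0 < k)%N ->
  (forall x, dfilt k (h x)) ->
  (forall x y, comm (h x) (h y) = 0) ->
  (forall u v, u != v -> exists x, h x (u, u) != h x (v, v)) ->
  exists psi, inn1 psi /\ forall x, dfilt k.+1 (psi (h x)).
Proof.
move=> k0 hk hcomm hsep.
pose b : incfun := [ffun p => if (p.1 <= p.2)%O && (ilen p.1 p.2 == k) then
   if [pick x | h x (p.1, p.1) != h x (p.2, p.2)] is Some x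
   then h x p / (h x (p.1, p.1) - h x (p.2, p.2)) else 0 else 0].
have bk : filt k b.
  move=> u v; rewrite ffunE /=; case: (u <= v)%O => //=.
  by case: eqP => // ->; rewrite leqnn.
have bP u v y : u != v -> (u <= v)%O -> ilen u v = k ->
    h y (u, v) = (h y (u, u) - h y (v, v)) * b (u, v).
  move=> nuv uv kuv; rewrite ffunE /= uv kuv eqxx /=.
  case: pickP => [x hx|hx]; last first.
    by have [x] := hsep u v nuv; rewrite hx.
  (* The [(u, v)] entry of the vanishing bracket says that the quotient defining [b] is the same for
     every separating [x]. *)
  have := congr1 (fun f : incfun => f (u, v)) (hcomm x y).
  rewrite subffE !(conv_dfilt _ _ nuv kuv) // ffunE => e.
  move: hx; rewrite -subr_eq0 => hx.
  apply: (mulIf hx); rewrite mulrA mulfVK //.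
  by apply/subr0_eq; rewrite -[RHS]e; ring.
pose be := ione + b.
have beb : be - ione = b by rewrite /be addrC addKr.
have be1 : filt 1 (be - ione) by rewrite beb; apply: filtW bk.
have beI := unipotent_incid be1.
have [g [gb psiI]] := inn1_conj be1; exists (fun f => be ** f ** g); split=> // x.
have hI := dfilt_incid (hk x).
pose h' := be ** h x ** g; rewrite -/h'.
have h'I : h' \in incid by apply: (inn1_incid psiI).
(* Comparing entries in this form avoids computing those of the inverse [g]. *)
have h'be : h' ** be = be ** h x by rewrite /h' -convA gb conv1r.
clearbody h'.
have beu u : be (u, u) = 1.
  exact: (proj1 (unipotentP beI)).
have beuv u v : u != v -> be (u, v) = b (u, v).
  by move=> nuv; rewrite !ffunE /= (negbTE nuv) add0r.
have h'u u : h' (u, u) = h x (u, u).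
  have := congr1 (fun f : incfun => f (u, u)) h'be.
  by rewrite !conv_diag // beu mul1r mulr1.
have dbe : dfilt k be by move=> u v nuv nk; rewrite beuv // bk.
(* The conjugate is known at first only to be in [incid]. Below length [k] both [h x] and [b] vanish
   off the diagonal; at length [k] the choice of [b] cancels [h x]. *)
suff main j : (j <= k)%N -> dfilt j.+1 h' by apply: main.
elim: j => [|j IH] jk; first exact: dfilt1.
have dj : dfilt j.+1 h' by apply: IH; apply: ltnW.
have jW f : dfilt k f -> dfilt j.+1 f.
  move=> F u v nuv nj; apply: F => //; apply: contra nj => /andP[-> h1].
  exact: leq_trans h1.
apply: dfiltS dj _ => u v nuv uv juv.
have := congr1 (fun f : incfun => f (u, v)) h'be.
rewrite !(conv_dfilt _ _ nuv juv) //; try exact: jW; try exact: IH (ltnW jk).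
rewrite !beu !beuv // h'u mulr1 mul1r => e.
have -> : h' (u, v) = h x (u, v) - (h x (u, u) - h x (v, v)) * b (u, v).
  by apply: (addrI (h x (u, u) * b (u, v))); rewrite e; ring.
have [jk'|jk'] := eqVneq j.+1 k; first by rewrite -bP ?subrr // juv.
have lk : (ilen u v < k)%N by rewrite juv ltn_neqAle jk'.
rewrite (hk x) ?bk ?mulr0 ?subrr //.
all: by rewrite negb_and -ltnNge lk orbT.
Qed.

Definition dpart f : incfun := [ffun p => if p.1 == p.2 then f p else 0].

Lemma dpartE f : dpart f = \sum_x iscale (f (x, x)) (eunit K x x).
Proof.
apply/ffunP=> -[u v]; rewrite sum_ffunE !ffunE /=; case: eqP => [<-|/eqP nuv].
  rewrite (bigD1 u) //= big1 => [|x nx].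
    by rewrite !ffunE eqxx mulr1 addr0.
  by rewrite !ffunE xpair_eqE eq_sym (negbTE nx) mulr0.
rewrite big1 // => x _; rewrite !ffunE xpair_eqE.
by case: eqP => [<-|]; rewrite ?mulr0 //= eq_sym (negbTE nuv) mulr0.
Qed.

Lemma dpart_incid f : dpart f \in incid.
Proof.
apply/filt0P=> u v; rewrite leq0n andbT ffunE /=.
by case: eqP => // ->; rewrite lexx.
Qed.

Lemma filt1_dpart f : f \in incid -> filt 1 (f - dpart f).
Proof.
move=> F; apply: filt1P; first by rewrite incidB ?dpart_incid.
by move=> x; rewrite subffE ffunE eqxx subrr.
Qed.

Lemma laut_dpart phi f : lie_aut phi ->
  phi (dpart f) = \sum_x iscale (f (x, x)) (phi (eunit K x x)).
Proof. by move=> L; rewrite dpartE (laut_sum L) // => x _; apply: incid_eunit. Qed.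

(** [f - dpart f] lies in F_1, which [phi] preserves, so its image has zero diagonal. *)
Lemma laut_dpart_diag phi f u : lie_aut phi -> f \in incid ->
  phi (dpart f) (u, u) = phi f (u, u).
Proof.
move=> L F; apply/esym/subr0_eq; rewrite -subffE -(lautB L) ?dpart_incid //.
exact/filt_diag/(laut_filt L)/filt1_dpart.
Qed.

(** Otherwise every element of the image of [phi] would have equal entries at [(u, u)] and [(v, v)],
    but e_uu is in the image. *)
Lemma laut_sep phi u v : lie_aut phi -> u != v ->
  exists x, phi (eunit K x x) (u, u) != phi (eunit K x x) (v, v).
Proof.
move=> L nuv; apply/existsP; apply: contraT => /existsPn H.
have [f F fu] := laut_surj L (incid_eunit (lexx u)).
have : phi (dpart f) (u, u) = phi (dpart f) (v, v).
  rewrite (laut_dpart f L) !sum_ffunE; apply: eq_bigr => x _; rewrite !ffunE.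
  by move: (H x); rewrite negbK => /eqP->.
rewrite !laut_dpart_diag // fu !ffunE !xpair_eqE eqxx eq_sym (negbTE nuv).
by move/eqP; rewrite oner_eq0.
Qed.

(** [conj_diag_step] can be iterated because [psi \o phi] is again a Lie automorphism: images of the
    e_xx still commute and separate points. *)
Lemma laut_diagonalize phi k : lie_aut phi ->
  exists psi, inn1 psi /\ forall x, dfilt k.+1 (psi (phi (eunit K x x))).
Proof.
move=> L; elim: k => [|k [psi [psiI H]]].
  exists (fun f => f); split=> [|x]; first exact: inn1_id.
  by apply: dfilt1; apply: laut_incid => //; apply: incid_eunit.
have M := laut_comp (inn1_laut psiI) L.
have [//||u v nuv|chi [chiI C]] := conj_diag_step _ H.
- move=> x y.
  have xI := @incid_eunit x x (lexx x); have yI := @incid_eunit y y (lexx y).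
  rewrite -(laut_comm (inn1_laut psiI)) ?(laut_incid L) // -(laut_comm L) //.
  suff -> : comm (eunit K x x) (eunit K y y) = 0.
    by rewrite (laut0 L) (laut0 (inn1_laut psiI)).
  rewrite /comm !conv_eunit eq_sym; case: eqP => [->|_]; first by rewrite subrr.
  by apply/ffunP=> p; rewrite !ffunE !mul0r subrr.
- exact: (laut_sep M nuv).
- by exists (chi \o psi); split=> //; apply: inn1_comp.
Qed.

(** * Automorphisms preserving the grading *)

(** For a Lie automorphism this means that every L_i is mapped into itself. *)
Definition graded (theta : incfun -> incfun) :=
  forall x y, (x <= y)%O -> forall u v, ilen u v != ilen x y ->
    theta (eunit K x y) (u, v) = 0.

Lemma comm_diagonal f g u v : (forall s t, s != t -> f (s, t) = 0) ->
  comm f g (u, v) = (f (u, u) - f (v, v)) * g (u, v).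
Proof.
move=> F; rewrite subffE !ffunE /= (bigD1 u) //= big1 => [|t ntu]; last first.
  by rewrite F ?mul0r // eq_sym.
rewrite (bigD1 v) //= big1 => [|t ntv]; last by rewrite F ?mulr0.
by rewrite !addr0; ring.
Qed.

(** For [x < y] the image of e_xy is a common eigenvector of the diagonal subalgebra, supported at a
    single pair [(u, v)]; the filtration, applied to [psi] and to its inverse, forces equal
    lengths. *)
Lemma laut_graded psi : lie_aut psi ->
  (forall x u v, u != v -> psi (eunit K x x) (u, v) = 0) -> graded psi.
Proof.
move=> L D x y xy u v nl.
have psiD f s t : s != t -> psi (dpart f) (s, t) = 0.
  move=> nst; rewrite (laut_dpart f L) sum_ffunE big1 // => z _.
  by rewrite ffunE D ?mulr0.
have [exy|nxy] := eqVneq x y.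
  by rewrite exy D //; apply: contra nl => /eqP->; rewrite exy !ilen_refl.
pose g := psi (eunit K x y).
have gF : filt (ilen x y) g by apply: (laut_filt L); apply: filt_eunit.
(* With [psi f] = e_ww, the map [psi] carries the eigenvector equation of e_xy under [dpart f] to
   one of [g] under a matrix with the diagonal of e_ww. *)
have weight w : exists c, forall s t,
    ((s == w)%:R - (t == w)%:R) * g (s, t) = c * g (s, t) :> K.
  have [f F fw] := laut_surj L (incid_eunit (lexx w)).
  exists (f (x, x) - f (y, y)) => s t.
  have e : comm (dpart f) (eunit K x y) = iscale (f (x, x) - f (y, y)) (eunit K x y).
    apply/ffunP=> -[a b]; rewrite comm_diagonal => [|a' b' nab]; last first.
      by rewrite ffunE (negbTE nab).
    by rewrite !ffunE /= !eqxx; case: eqP => [[-> ->]|_]; rewrite ?mulr0.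
  have pf a : psi (dpart f) (a, a) = (a == w)%:R.
    by rewrite laut_dpart_diag // fw ffunE xpair_eqE andbb.
  have := congr1 psi e; rewrite (laut_comm L) ?dpart_incid ?incid_eunit //.
  rewrite (lautZ L) ?incid_eunit // => /(congr1 (fun f : incfun => f (s, t))).
  rewrite comm_diagonal; last by move=> a b; apply: psiD.
  by rewrite !pf ffunE.
have [//|guv] := eqVneq (g (u, v)) 0.
have [uv luv] : (u <= v)%O /\ (ilen x y <= ilen u v)%N.
  by apply/andP; apply: contraNT guv => /gF->.
have nuv : u != v.
  by rewrite -ilen_eq0 // -lt0n (leq_trans _ luv) // lt0n ilen_eq0.
(* the root of e_uv is nonzero and determines the pair (u, v) *)
have line s t : g (s, t) != 0 -> (s, t) = (u, v).
  move=> gst.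
  have st : (s <= t)%O.
    have : (s <= t)%O && (ilen x y <= ilen s t)%N by apply: contraNT gst => /gF->.
    by case/andP.
  have same w : (s == w)%:R - (t == w)%:R = (u == w)%:R - (v == w)%:R :> K.
    have [c cw] := weight w.
    by rewrite (mulIf gst (cw s t)) (mulIf guv (cw u v)).
  have := same u; have := same v; rewrite !eqxx (negbTE nuv) [v == u]eq_sym (negbTE nuv).
  case: (eqVneq s u) => [su|nsu]; case: (eqVneq t v) => [tv|ntv].
  - by rewrite su tv.
  - rewrite su (negbTE nuv) !subr0 sub0r => /eqP.
    by rewrite eq_sym oppr_eq0 oner_eq0.
  - case: (eqVneq s v) => [sv|nsv].
      by rewrite subrr sub0r => /eqP; rewrite eq_sym oppr_eq0 oner_eq0.
    rewrite tv [v == u]eq_sym (negbTE nuv) subrr subr0 => _ /eqP.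
    by rewrite eq_sym oner_eq0.
  - case: (eqVneq s v) => [sv|nsv]; last first.
      by rewrite subrr sub0r => /eqP; rewrite eq_sym oppr_eq0 oner_eq0.
    (* In characteristic 2 the roots of e_uv and e_vu coincide, so the swapped pair is excluded by
       the order. *)
    case: (eqVneq t u) => [tu|ntu].
      by case/negP: nuv; rewrite eq_le uv -sv -tu st.
    by rewrite subrr subr0 => _ /eqP; rewrite eq_sym oner_eq0.
have gE : g = iscale (g (u, v)) (eunit K u v).
  apply/ffunP=> -[s t]; rewrite !ffunE; case: eqP => [->|nst]; first by rewrite mulr1.
  by rewrite mulr0; apply/eqP; apply: contraT => /line.
(* Here [ilen u v] exceeds [ilen x y], so [chi] sends e_uv to an element vanishing at [(x, y)], yet
   a multiple of that element is e_xy. *)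
have [chi [M [_ cp]]] := laut_inv L.
have : iscale (g (u, v)) (chi (eunit K u v)) = eunit K x y.
  by rewrite -(lautZ M) ?incid_eunit // -gE; apply: cp; apply: incid_eunit.
move/(congr1 (fun f : incfun => f (x, y))); rewrite !ffunE eqxx.
rewrite (laut_filt M (filt_eunit uv)) ?mulr0.
  by move/eqP; rewrite eq_sym oner_eq0.
by rewrite xy -ltnNge ltn_neqAle luv eq_sym nl.
Qed.

(** * Graded parts and the factorization of a Lie automorphism *)

(** If [phi - theta] raises degree, both maps have the same L_i-component on L_i, and for [theta]
    that is everything. *)
Lemma tilde_unique phi theta : lie_aut theta -> graded theta ->
  (forall k f, filt k f -> filt k.+1 (phi f - theta f)) -> eqI (tilde phi) theta.
Proof.
move=> L G H f F; rewrite (laut_expand L F) /tilde; apply: eq_bigr => -[x y] /= xy.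
congr iscale; apply/ffunP=> -[u v]; rewrite ffunE /=.
case: eqP => [euv|/eqP nuv]; last by rewrite G.
apply/subr0_eq; rewrite -subffE (H _ _ (filt_eunit xy)) //.
by rewrite euv ltnn andbF.
Qed.

Lemma tilde_inn1_comp phi psi theta : inn1 psi -> lie_aut theta -> graded theta ->
  eqI phi (psi \o theta) -> eqI (tilde phi) theta.
Proof.
move=> I L G e; apply: tilde_unique => // k f F.
by rewrite e ?(filt_incid F) //; apply/(inn1_filt I)/(laut_filt L).
Qed.

Lemma tilde_graded theta : lie_aut theta -> graded theta -> eqI (tilde theta) theta.
Proof. by move=> L G; apply: (tilde_inn1_comp inn1_id). Qed.

Lemma laut_id : lie_aut id.
Proof. exact: inn1_laut inn1_id. Qed.

Lemma graded_id : graded id.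
Proof.
move=> x y _ u v nl; rewrite ffunE.
by case: ((u, v) =P (x, y)) nl => // -[-> ->]; rewrite eqxx.
Qed.

Lemma graded_eq phi psi : eqI phi psi -> graded phi -> graded psi.
Proof. by move=> e G x y xy u v nl; rewrite -e ?G // incid_eunit. Qed.

Lemma graded_comp phi psi : lie_aut phi -> lie_aut psi -> graded phi -> graded psi ->
  graded (phi \o psi).
Proof.
move=> L M G H x y xy u v nl /=.
rewrite (laut_expand L) ?(laut_incid M) ?incid_eunit // sum_ffunE big1 // => -[s t] /= st.
rewrite ffunE; have [e|ne] := eqVneq (ilen s t) (ilen x y).
  by rewrite G ?mulr0 // e.
by rewrite H ?mul0r.
Qed.

Lemma laut_decomp phi : lie_aut phi -> exists psi theta,
  [/\ inn1 psi, lie_aut theta, graded theta & eqI phi (psi \o theta)].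
Proof.
(* No interval has length [#|X|.+1], so at this level the images of the e_xx are diagonal. *)
move=> L; have [chi [chiI H]] := laut_diagonalize #|X| L.
have [psi [psiI [_ pc]]] := inn1_inv chiI.
have M := laut_comp (inn1_laut chiI) L.
exists psi, (chi \o phi); split=> //.
  by apply: laut_graded => // x u v nuv; apply: dfilt_max nuv; apply: H.
by move=> f F; apply/esym/pc/(laut_incid L).
Qed.

(** * The group LAut~ and the semidirect product *)

(** The graded factor of [phi] in [laut_decomp] is [tilde phi]; conversely a graded automorphism is
    its own [tilde]. *)
Lemma lautTP theta : lautT theta <-> lie_aut theta /\ graded theta.
Proof.
split=> [[phi [L e]]|[L G]]; last first.
  by exists theta; split=> // f F; rewrite tilde_graded.
have [psi [theta' [I L' G' e']]] := laut_decomp L.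
have ee : eqI theta' theta by move=> f F; rewrite e // (tilde_inn1_comp I L' G' e').
by split; [apply: laut_eq ee L'|apply: graded_eq ee G'].
Qed.

Lemma lautT_comp theta1 theta2 :
  lautT theta1 -> lautT theta2 -> lautT (theta1 \o theta2).
Proof.
move=> /lautTP[L1 G1] /lautTP[L2 G2]; apply/lautTP.
by split; [apply: laut_comp|apply: graded_comp].
Qed.

(** Writing the inverse as [psi \o theta'] gives id = [psi \o (theta' \o theta)]; taking graded
    parts yields [theta' \o theta] = id. *)
Lemma lautT_inv theta : lautT theta ->
  exists theta', lautT theta' /\ eqI (theta \o theta') id /\ eqI (theta' \o theta) id.
Proof.
move=> /lautTP[L G]; have [chi [M [tc ct]]] := laut_inv L.
have [psi [theta' [I L' G' e]]] := laut_decomp M.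
have L'' := laut_comp L' L; have G'' := graded_comp L' L G' G.
have t't f : f \in incid -> theta' (theta f) = f.
  move=> F; rewrite -[RHS](tilde_graded laut_id graded_id) //.
  apply/esym; apply: (tilde_inn1_comp I L'' G'') => // h H.
  by have /= <- := e _ (laut_incid L H); rewrite -[LHS](ct h H).
exists theta'; split; [exact/lautTP|split=> // f F].
(* A left inverse suffices since [theta] is onto: [f] is [theta (chi f)]. *)
rewrite -{1}(tc f F) /= t't; first exact: tc.
exact: (laut_incid M).
Qed.

(** [theta] is its own graded part, and the graded part of an element of Inn_1 is the identity. *)
Lemma inn1_lautT_id theta : inn1 theta -> lautT theta -> eqI theta id.
Proof.
move=> I /lautTP[L G] f F; rewrite -(tilde_graded L G) //.
exact: (tilde_inn1_comp I laut_id graded_id).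
Qed.

(* A conjugate of an element of Inn_1 is trivial on the graded algebra, so its
   factor in LAut~ is the identity. *)
Lemma inn1_normal phi psi : lie_aut phi -> inn1 psi ->
  exists chi, inn1 chi /\ eqI (phi \o psi) (chi \o phi).
Proof.
move=> L I; have [phi' [L' [pp' p'p]]] := laut_inv L; have M := inn1_laut I.
pose chi := phi \o psi \o phi'.
have C : lie_aut chi by apply: laut_comp => //; apply: laut_comp.
have [psi' [theta [I' LT GT e]]] := laut_decomp C.
have t1 : eqI (tilde chi) id.
  apply: tilde_unique; [exact: laut_id|exact: graded_id|move=> k f F].
  (* With [h = phi' f], the difference [chi f - f] is [phi (psi h - h)], of higher degree. *)
  have FI := filt_incid F; rewrite -{2}(pp' f FI) /= -(lautB L).
  - exact/(laut_filt L)/(inn1_filt I)/(laut_filt L').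
  - exact/(laut_incid M)/(laut_incid L').
  - exact: (laut_incid L').
have t2 := tilde_inn1_comp I' LT GT e.
(* The graded factor [theta] of [chi] is the identity, so [chi] agrees with [psi']. *)
exists psi'; split=> // f F /=.
have pF := laut_incid L F; have := e _ pF; rewrite /= -t2 // t1 // => <-.
by rewrite /chi /=; congr (phi (psi _)); apply/esym/p'p.
Qed.

Lemma laut_inn1_lautT phi : lie_aut phi ->
  exists psi theta, inn1 psi /\ lautT theta /\ eqI phi (psi \o theta).
Proof.
move=> /laut_decomp[psi [theta [I L G e]]].
by exists psi, theta; split=> //; split=> //; apply/lautTP.
Qed.

End IncidenceAlgebra.

(* LAut(I(X,K)) is the internal semidirect product Inn_1 ⋊ LAut~ :
   Inn_1 is a normal subgroup, LAut~ is a subgroup, they intersect trivially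
   and every Lie automorphism is a product of an element of Inn_1 and one of
   LAut~. Group law: composition (maps compared on I(X,K)). *)
Theorem theorem4p15 (K : fieldType) (d : Order.disp_t) (X : finPOrderType d) :
  connected_poset X ->
  (* Inn_1 is a subgroup of LAut *)
  (forall psi : {ffun X * X -> K} -> {ffun X * X -> K},
     inn1 psi -> lie_aut psi) /\
  (forall psi1 psi2 : {ffun X * X -> K} -> {ffun X * X -> K},
     inn1 psi1 -> inn1 psi2 -> inn1 (psi1 \o psi2)) /\
  (forall psi : {ffun X * X -> K} -> {ffun X * X -> K}, inn1 psi ->
     exists psi', inn1 psi' /\ eqI (psi \o psi') id /\ eqI (psi' \o psi) id) /\
  (* Inn_1 is normal in LAut *)
  (forall phi psi : {ffun X * X -> K} -> {ffun X * X -> K},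
     lie_aut phi -> inn1 psi ->
     exists chi, inn1 chi /\ eqI (phi \o psi) (chi \o phi)) /\
  (* LAut~ is a subgroup of LAut *)
  (forall theta : {ffun X * X -> K} -> {ffun X * X -> K},
     lautT theta -> lie_aut theta) /\
  (forall theta1 theta2 : {ffun X * X -> K} -> {ffun X * X -> K},
     lautT theta1 -> lautT theta2 -> lautT (theta1 \o theta2)) /\
  (forall theta : {ffun X * X -> K} -> {ffun X * X -> K}, lautT theta ->
     exists theta', lautT theta' /\ eqI (theta \o theta') id /\ eqI (theta' \o theta) id) /\
  (* trivial intersection *)
  (forall theta : {ffun X * X -> K} -> {ffun X * X -> K},
     inn1 theta -> lautT theta -> eqI theta id) /\
  (* LAut = Inn_1 . LAut~ *)
  (forall phi : {ffun X * X -> K} -> {ffun X * X -> K}, lie_aut phi ->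
     exists psi theta, inn1 psi /\ lautT theta /\ eqI phi (psi \o theta)).
Proof.
move=> _; split; first exact: inn1_laut.
split; first exact: inn1_comp.
split; first exact: inn1_inv.
split; first exact: inn1_normal.
split; first by move=> theta /lautTP[].
split; first exact: lautT_comp.
split; first exact: lautT_inv.
split; first exact: inn1_lautT_id.
exact: laut_inn1_lautT.
Qed.
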